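(* Let $L>K\ge1$ and $0<\Delta<0.5$. Let $E=\{1,\dots,L\}$ and let $B_1,\dots,B_K$ be a partition of $E$ into nonempty sets. Let $\mathcal I=\{I\subseteq E:\ |I\cap B_k|\le1\ \text{for all }k\}$ (a partition matroid of rank $K$). Let $P$ be the distribution under which the weights $w(e)$, $e\in E$, are independent Bernoulli random variables with means $\bar w(e)=0.5$ if $e=\min_{i\in B_k}i$ for the block $B_k$ containing $e$, and $\bar w(e)=0.5-\Delta$ otherwise. Then for any consistent algorithm, the expected cumulative regret on the matroid bandit $((E,\mathcal I),P)$ satisfies $$\liminf_{n\to\infty}\frac{R(n)}{\log n}\ge\frac{L-K}{4\Delta}.$$
   Context: A matroid bandit is a pair $(M,P)$ where $M=(E,\mathcal I)$ is a matroid on $E=\{1,\dots,L\}$ and $P$ is a distribution on $[0,1]^L$; in each episode $t$ a weight vector $w_t\sim P$ is drawn i.i.d., the algorithm chooses a basis (maximal independent set) $A^t$ based on past observations, gains $f(A^t,w_t)=\sum_{e\in A^t}w_t(e)$ and observes $w_t(e)$ for $e\in A^t$. With $\bar w=\mathbb E[w]$ and $A^*$ a basis maximizing $\sum_{e\in A}\bar w(e)$, the expected cumulative regret is $R(n)=\mathbb E\big[\sum_{t=1}^n(f(A^*,w_t)-f(A^t,w_t))\big]$. An algorithm is consistent if for every matroid bandit, every suboptimal item $e\in E\setminus A^*$ and every $\alpha>0$, $\mathbb E[T_e(n)]=o(n^\alpha)$, where $T_e(n)$ is the number of episodes among the first $n$ in which $e$ is chosen. *)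

(* Defs.v *)
From HB Require Import structures.
From mathcomp Require Import all_boot all_order all_algebra.
From mathcomp Require Import all_classical all_reals all_analysis.
Set Implicit Arguments. Unset Strict Implicit. Unset Printing Implicit Defensive.
Import Order.TTheory GRing.Theory Num.Theory.
Local Open Scope classical_set_scope.
Local Open Scope ring_scope.

Definition is_matroid (T : finType) (I : {set {set T}}) : Prop :=
  [/\ finset.set0 \in I,
      (forall A B : {set T}, B \in I -> A \subset B -> A \in I) &
      (forall A B : {set T}, A \in I -> B \in I -> (#|A| < #|B|)%N ->
         exists2 x, x \in B :\: A & x |: A \in I)].

Definition is_basis (T : finType) (I : {set {set T}}) (A : {set T}) : Prop :=
  A \in I /\ (forall B, B \in I -> A \subset B -> B = A).

Section Bandit.
Variable R : realType.

(** A finitely supported probability distribution on [0,1]^L: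
    a list of (atom, probability) pairs. *)
Definition is_fdist (L : nat) (D : seq ('rV[R]_L * R)) : Prop :=
  [/\ (forall xp, xp \in D -> 0 <= xp.2),
      \sum_(xp <- D) xp.2 = 1 &
      (forall xp i, xp \in D -> 0 <= xp.1 ord0 i <= 1)].

Definition mean (L : nat) (D : seq ('rV[R]_L * R)) (e : 'I_L) : R :=
  \sum_(xp <- D) xp.2 * xp.1 ord0 e.

Definition fval (L : nat) (A : {set 'I_L}) (w : 'rV[R]_L) : R :=
  \sum_(e in A) w ord0 e.

Definition optimal_basis (L : nat) (I : {set {set 'I_L}})
  (D : seq ('rV[R]_L * R)) (A : {set 'I_L}) : Prop :=
  is_basis I A /\
  (forall B, is_basis I B -> \sum_(e in B) mean D e <= \sum_(e in A) mean D e).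

(** Observed part of w when playing A (unobserved coordinates masked to 0). *)
Definition mask (L : nat) (A : {set 'I_L}) (w : 'rV[R]_L) : 'rV[R]_L :=
  \row_i (if i \in A then w ord0 i else 0).

(** A (possibly randomized) policy: maps the observed history
    (chosen sets and observed weights) to a distribution on sets. *)
Definition policy (L : nat) :=
  seq ({set 'I_L} * 'rV[R]_L) -> {set 'I_L} -> R.

Definition algorithm := forall L : nat, {set {set 'I_L}} -> policy L.

Definition observed (L : nat) (tr : seq ({set 'I_L} * 'rV[R]_L)) :=
  [seq (aw.1, mask aw.1 aw.2) | aw <- tr].

(** Expected value of a functional G of the full trajectory
    ((A^1,w_1),...,(A^n,w_n)) when w_t ~ D i.i.d. and A^t ~ pol(history). *)
Fixpoint exp_from (L : nat) (pol : policy L) (D : seq ('rV[R]_L * R))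
  (G : seq ({set 'I_L} * 'rV[R]_L) -> R) (k : nat)
  (tr : seq ({set 'I_L} * 'rV[R]_L)) : R :=
  match k with
  | 0 => G tr
  | k'.+1 => \sum_(A : {set 'I_L}) pol (observed tr) A *
              \sum_(xp <- D) xp.2 * exp_from pol D G k' (rcons tr (A, xp.1))
  end.

Definition expect (L : nat) (pol : policy L) (D : seq ('rV[R]_L * R))
  (n : nat) (G : seq ({set 'I_L} * 'rV[R]_L) -> R) : R :=
  exp_from pol D G n [::].

Definition exp_pulls (L : nat) (pol : policy L) (D : seq ('rV[R]_L * R))
  (e : 'I_L) (n : nat) : R :=
  expect pol D n (fun tr => (count (fun aw : {set 'I_L} * 'rV[R]_L => e \in aw.1) tr)%:R).

Definition regret (L : nat) (pol : policy L) (D : seq ('rV[R]_L * R))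
  (Astar : {set 'I_L}) (n : nat) : R :=
  expect pol D n (fun tr => \sum_(aw <- tr) (fval Astar aw.2 - fval aw.1 aw.2)).

Definition valid_algorithm (alg : algorithm) : Prop :=
  forall (L : nat) (I : {set {set 'I_L}}), is_matroid I ->
  forall h : seq ({set 'I_L} * 'rV[R]_L),
    [/\ (forall A, 0 <= alg L I h A),
        \sum_(A : {set 'I_L}) alg L I h A = 1 &
        (forall A, alg L I h A != 0 -> is_basis I A)].

Definition consistent (alg : algorithm) : Prop :=
  forall (L : nat) (I : {set {set 'I_L}}), is_matroid I ->
  forall D : seq ('rV[R]_L * R), is_fdist D ->
  forall e : 'I_L, (forall A, optimal_basis I D A -> e \notin A) ->
  forall a : R, 0 < a ->
    (fun n : nat => exp_pulls (alg L I) D e n / powR n%:R a) @ \oo --> 0.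

Definition bernoulli_product (L : nat) (m : 'I_L -> R) : seq ('rV[R]_L * R) :=
  map (fun f : {ffun 'I_L -> bool} =>
         (\row_i (if f i then 1 else 0 : R),
          \prod_i (if f i then m i else 1 - m i)))
      (enum [set: {ffun 'I_L -> bool}]).

Definition partition_matroid (L K : nat) (B : 'I_K -> {set 'I_L})
  : {set {set 'I_L}} :=
  [set I : {set 'I_L} | [forall k, #|I :&: B k| <= 1]%N].

Definition block_means (L K : nat) (B : 'I_K -> {set 'I_L}) (Delta : R)
  (e : 'I_L) : R :=
  if [exists k, (e \in B k) && [forall i in B k, (e <= i)%N]]
  then 2^-1 else 2^-1 - Delta.

End Bandit.

(* Main.v *)
Require Import Defs.
From HB Require Import structures.
From mathcomp Require Import all_boot all_order all_algebra.
From mathcomp Require Import all_classical all_reals all_analysis.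
From mathcomp Require Import ring lra.
Import Order.TTheory GRing.Theory Num.Theory.
Import numFieldNormedType.Exports.
Local Open Scope ring_scope.
Set Implicit Arguments.
Unset Strict Implicit.
Unset Printing Implicit Defensive.

(* A Lai-Robbins change of measure, run separately for each suboptimal item e.
   Raising the mean of e to 1/2 + eps makes e optimal, so consistency gives
   E[T_e(n)] + E'[n - T_e(n)] <= n^a eventually.  Let X be the likelihood ratio
   of the two environments; only observations of e contribute to it, so
   E[ln X] = - E[T_e(n)] kl with kl <= (Delta + eps)^2 / (1/4 - eps^2).
   Instead of an event, interpolate with theta = T_e(n) / n: the variable
   Y = theta + (1 - theta) X satisfies ln X - X <= ln Y, and
   E[Y] = (E[T_e(n)] + E'[n - T_e(n)]) / n <= n^(a - 1), whence by Jensen's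
   inequality (in its tangent form at n^(a - 1))
   E[T_e(n)] kl >= (1 - a) ln n - 1. *)

(** * Expectations over trajectories *)

Lemma exp_from_lin (R : realType) (L : nat) (pol : policy R L)
  (D : seq ('rV[R]_L * R)) (c : R) G1 G2 k tr :
  exp_from pol D (fun t => c * G1 t + G2 t) k tr =
  c * exp_from pol D G1 k tr + exp_from pol D G2 k tr.
Proof.
elim: k tr => [//|k IHk] tr /=.
rewrite mulr_sumr -big_split /=; apply: eq_bigr => A _.
rewrite mulrCA -mulrDr; congr (_ * _).
rewrite mulr_sumr -big_split /=; apply: eq_bigr => xp _.
by rewrite IHk mulrDr mulrCA.
Qed.

Lemma exp_from_sum (R : realType) (L : nat) (pol : policy R L)
  (D : seq ('rV[R]_L * R)) (I : finType) (P : pred I)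
  (G : I -> seq ({set 'I_L} * 'rV[R]_L) -> R) k tr :
  exp_from pol D (fun t => \sum_(i | P i) G i t) k tr =
  \sum_(i | P i) exp_from pol D (G i) k tr.
Proof.
elim: k tr => [//|k IHk] tr /=.
rewrite exchange_big /=; apply: eq_bigr => A _; rewrite -mulr_sumr.
congr (_ * _); rewrite exchange_big /=; apply: eq_bigr => xp _.
by rewrite IHk mulr_sumr.
Qed.

Lemma exp_from_const (R : realType) (L : nat) (pol : policy R L)
  (D : seq ('rV[R]_L * R)) (c : R) k tr :
  (forall h, \sum_A pol h A = 1) -> \sum_(xp <- D) xp.2 = 1 ->
  exp_from pol D (fun=> c) k tr = c.
Proof.
move=> pol1 D1; elim: k tr => [//|k IHk] tr /=.
under eq_bigr => A _.
  by under eq_bigr => xp _ do rewrite IHk; rewrite -mulr_suml D1 mul1r; over.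
by rewrite -mulr_suml pol1 mul1r.
Qed.

(** The induction only needs to append sets that [pol] plays with nonzero probability, so [G1] and
    [G2] are compared only on trajectories of the final length whose sets all satisfy [P], for
    instance being a basis. *)
Lemma exp_from_le (R : realType) (L : nat) (pol : policy R L)
  (D : seq ('rV[R]_L * R)) (P : {set 'I_L} -> Prop) G1 G2 k tr :
  (forall h A, 0 <= pol h A) -> (forall h A, pol h A != 0 -> P A) ->
  (forall xp, xp \in D -> 0 <= xp.2) ->
  (forall aw, aw \in tr -> P aw.1) ->
  (forall t, size t = (k + size tr)%N -> (forall aw, aw \in t -> P aw.1) ->
     G1 t <= G2 t) ->
  exp_from pol D G1 k tr <= exp_from pol D G2 k tr.
Proof.
move=> pol0 polP D0; elim: k tr => [|k IHk] tr trP G12 /=; first exact: G12.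
apply: ler_sum => A _; have [->|/polP PA] := eqVneq (pol (observed tr) A) 0.
  by rewrite !mul0r.
apply: ler_wpM2l => //; rewrite big_seq [leRHS]big_seq.
apply: ler_sum => xp xpD; apply: ler_wpM2l; first exact: D0.
apply: IHk => [aw|t szt]; last by apply: G12; rewrite szt size_rcons addnS.
by rewrite mem_rcons inE => /predU1P[->|/trP].
Qed.

(* Only the conditional mean of the increment given the played set matters. *)
Lemma exp_from_additive (R : realType) (L : nat) (pol : policy R L)
  (D : seq ('rV[R]_L * R)) (h1 h2 : {set 'I_L} * 'rV[R]_L -> R) k tr :
  (forall h, \sum_A pol h A = 1) -> \sum_(xp <- D) xp.2 = 1 ->
  (forall A, \sum_(xp <- D) xp.2 * h1 (A, xp.1) =
             \sum_(xp <- D) xp.2 * h2 (A, xp.1)) ->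
  exp_from pol D (fun t => \sum_(aw <- t) h1 aw) k tr
    - \sum_(aw <- tr) h1 aw =
  exp_from pol D (fun t => \sum_(aw <- t) h2 aw) k tr
    - \sum_(aw <- tr) h2 aw.
Proof.
move=> pol1 D1 h12; elim: k tr => [|k IHk] tr /=; first by rewrite !subrr.
apply/eqP; rewrite subr_eq; apply/eqP.
transitivity (\sum_A pol (observed tr) A *
  (\sum_(xp <- D) xp.2 * exp_from pol D (fun t => \sum_(aw <- t) h2 aw) k
     (rcons tr (A, xp.1)) +
   (\sum_(aw <- tr) h1 aw - \sum_(aw <- tr) h2 aw))).
  apply: eq_bigr => A _; congr (_ * _).
  pose X := \sum_(aw <- tr) h1 aw - \sum_(aw <- tr) h2 aw.
  (* The last two terms are the increments at the newly appended pair; their averages over [D]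
     cancel by [h12]. *)
  transitivity (\sum_(xp <- D) (xp.2 * exp_from pol D
     (fun t => \sum_(aw <- t) h2 aw) k (rcons tr (A, xp.1)) +
     (xp.2 * X + (xp.2 * h1 (A, xp.1) - xp.2 * h2 (A, xp.1))))).
    apply: eq_bigr => xp _; rewrite /X -mulrBr -!mulrDr; congr (_ * _).
    have /eqP := IHk (rcons tr (A, xp.1)).
    rewrite subr_eq => /eqP ->; rewrite !big_rcons /=; ring.
  by rewrite !big_split /= -mulr_suml D1 mul1r sumrN h12 subrr addr0.
rewrite (eq_bigr _ (fun A _ => mulrDr _ _ _)).
rewrite big_split /= -mulr_suml pol1; ring.
Qed.

Lemma expect_additive (R : realType) (L : nat) (pol : policy R L)
  (D : seq ('rV[R]_L * R)) (h1 h2 : {set 'I_L} * 'rV[R]_L -> R) n :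
  (forall h, \sum_A pol h A = 1) -> \sum_(xp <- D) xp.2 = 1 ->
  (forall A, \sum_(xp <- D) xp.2 * h1 (A, xp.1) =
             \sum_(xp <- D) xp.2 * h2 (A, xp.1)) ->
  expect pol D n (fun t => \sum_(aw <- t) h1 aw) =
  expect pol D n (fun t => \sum_(aw <- t) h2 aw).
Proof.
move=> pol1 D1 /(exp_from_additive n [::] pol1 D1).
by rewrite !big_nil !subr0.
Qed.

(* Change of measure: [r] is the density of [D'] with respect to [D] as seen
   through the mask. *)
Lemma exp_from_change (R : realType) (L : nat) (pol : policy R L)
  (D D' : seq ('rV[R]_L * R)) (r : {set 'I_L} * 'rV[R]_L -> R) G k tr :
  (forall A (g : 'rV[R]_L -> R), (forall w w', Defs.mask A w = Defs.mask A w' -> g w = g w') ->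
     \sum_(xp <- D') xp.2 * g xp.1 = \sum_(xp <- D) xp.2 * (r (A, xp.1) * g xp.1)) ->
  (forall t t', observed t = observed t' -> G t = G t') ->
  exp_from pol D (fun t => (\prod_(aw <- t) r aw) * G t) k tr =
  (\prod_(aw <- tr) r aw) * exp_from pol D' G k tr.
Proof.
move=> DD' Gobs; elim: k tr => [//|k IHk] tr /=.
(* The value of the remaining episodes depends on the past only through [observed]. As a function of
   the fresh weight it is therefore constant on the fibres of the mask, as [DD'] requires. *)
have obs t t' j : observed t = observed t' ->
    exp_from pol D' G j t = exp_from pol D' G j t'.
  elim: j t t' => [|j IHj] t t' tt' /=; first exact: Gobs.
  rewrite tt'; apply: eq_bigr => A _; congr (_ * _); apply: eq_bigr => xp _.
  by congr (_ * _); apply: IHj; rewrite /observed !map_rcons -/(observed t) tt'.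
rewrite mulr_sumr; apply: eq_bigr => A _; rewrite mulrCA; congr (_ * _).
rewrite (DD' A (fun w => exp_from pol D' G k (rcons tr (A, w)))); last first.
  by move=> w w' ww'; apply: obs; rewrite /observed !map_rcons /= ww'.
rewrite mulr_sumr; apply: eq_bigr => xp _.
by rewrite IHk big_rcons /=; ring.
Qed.

(** * Bernoulli products and their likelihood ratio *)

Definition bvec (R : realType) (L : nat) (f : {ffun 'I_L -> bool}) : 'rV[R]_L :=
  \row_i (if f i then 1 else 0).

Definition bprob (R : realType) (L : nat) (m : 'I_L -> R)
  (f : {ffun 'I_L -> bool}) : R := \prod_i (if f i then m i else 1 - m i).

(** Passing from a list of atoms to the finite type of Boolean vectors makes distributivity and
    bijective reindexing available. *)
Lemma bernoulli_productE (R : realType) (L : nat) (m : 'I_L -> R) (g : 'rV[R]_L -> R) :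
  \sum_(xp <- bernoulli_product m) xp.2 * g xp.1 =
  \sum_(f : {ffun 'I_L -> bool}) bprob m f * g (bvec R f).
Proof.
rewrite big_map big_enum /=; by apply: eq_bigl => f; exact: mem_setT.
Qed.

Lemma sum_bprob (R : realType) (L : nat) (m : 'I_L -> R) :
  \sum_(f : {ffun 'I_L -> bool}) bprob m f = 1.
Proof.
rewrite /bprob -(bigA_distr_bigA (fun i (b : bool) => if b then m i else 1 - m i)).
by rewrite big1 // => i _; rewrite big_bool /=; ring.
Qed.

Lemma sum_bernoulli_product (R : realType) (L : nat) (m : 'I_L -> R) :
  \sum_(xp <- bernoulli_product m) xp.2 = 1.
Proof.
under eq_bigr do rewrite -[_.2]mulr1.
rewrite (bernoulli_productE m (fun=> 1)).
by under eq_bigr do rewrite mulr1; exact: sum_bprob.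
Qed.

Lemma mean_bernoulli_product (R : realType) (L : nat) (m : 'I_L -> R) e :
  mean (bernoulli_product m) e = m e.
Proof.
rewrite /mean (bernoulli_productE m (fun w => w ord0 e)).
(* The extra factor [b%:R] at [e] absorbs the coordinate [e], so that the summand is a product over
   coordinates and sum and product can be exchanged. *)
pose F i (b : bool) := (if b then m i else 1 - m i) * (if i == e then b%:R else 1).
transitivity (\sum_(f : {ffun 'I_L -> bool}) \prod_i F i (f i)).
  apply: eq_bigr => f _; rewrite big_split /= mxE; congr (_ * _).
  by rewrite -big_mkcond big_pred1_eq; case: (f e).
rewrite -(bigA_distr_bigA F) (bigD1 e) //= [X in _ * X]big1 => [|i /negPf ie].
  by rewrite big_bool /F eqxx /=; ring.
by rewrite big_bool /F ie /=; ring.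
Qed.

Lemma is_fdist_bernoulli_product (R : realType) (L : nat) (m : 'I_L -> R) :
  (forall i, 0 <= m i <= 1) -> is_fdist (bernoulli_product m).
Proof.
move=> m01; split=> [xp /mapP[f _ ->]| |xp i /mapP[f _ ->]] /=.
- by apply: prodr_ge0 => i _; have := m01 i; case: (f i); lra.
- exact: sum_bernoulli_product.
- by rewrite mxE; case: (f i); lra.
Qed.

Lemma bernoulli_product_coord (R : realType) (L : nat) (m : 'I_L -> R) e (phi : R -> R) :
  \sum_(xp <- bernoulli_product m) xp.2 * phi (xp.1 ord0 e) =
  m e * phi 1 + (1 - m e) * phi 0.
Proof.
rewrite (bernoulli_productE m (fun w => phi (w ord0 e))).
(* On the values 0 and 1, [phi] agrees with an affine function, which reduces the claim to total
   mass and mean. *)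
transitivity (\sum_(f : {ffun 'I_L -> bool})
   (bprob m f * bvec R f ord0 e * (phi 1 - phi 0) + bprob m f * phi 0)).
  by apply: eq_bigr => f _; rewrite mxE; case: (f e); ring.
rewrite big_split /= -!mulr_suml sum_bprob.
rewrite -(bernoulli_productE m (fun w => w ord0 e)).
have := mean_bernoulli_product m e; rewrite /mean => ->; ring.
Qed.

(* Summing against the unobserved coordinate [e]: flipping it changes the sign
   of the difference of the two products and leaves [g] unchanged. *)
Lemma bprob_unobserved (R : realType) (L : nat) (m m' : 'I_L -> R) e
  (g : {ffun 'I_L -> bool} -> R) :
  (forall i, i != e -> m' i = m i) ->
  (forall f f' : {ffun 'I_L -> bool}, (forall i, i != e -> f i = f' i) -> g f = g f') ->
  \sum_f bprob m' f * g f = \sum_f bprob m f * g f.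
Proof.
move=> mm' ge; apply/eqP; rewrite -subr_eq0 -sumrB; apply/eqP.
pose flip (f : {ffun 'I_L -> bool}) := [ffun i => (i == e) (+) f i].
have flipK : involutive flip.
  by move=> f; apply/ffunP => i; rewrite !ffunE addbA addbb.
set S := LHS; suff : S = - S by lra.
rewrite {1}/S (reindex_inj (inv_inj flipK)) /= -sumrN; apply: eq_bigr => f _.
rewrite (ge (flip f) f) => [|i /negPf ie]; last by rewrite ffunE ie.
rewrite -!mulrBl -mulNr; congr (_ * _); rewrite /bprob.
rewrite !(bigD1 e (P := xpredT)) //= ffunE eqxx.
set P1 := \prod_(i | _) _; set P2 := \prod_(i | _) _.
set P3 := \prod_(i | _) _; set P4 := \prod_(i | _) _.
have -> : P1 = P4 by apply: eq_bigr => i ie; rewrite ffunE (negPf ie) mm'.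
have -> : P2 = P4 by apply: eq_bigr => i ie; rewrite ffunE (negPf ie).
have -> : P3 = P4 by apply: eq_bigr => i ie; rewrite mm'.
by case: (f e) => /=; ring.
Qed.

(** One-episode likelihood ratio of a Bernoulli variable of mean [q] to one of mean [p], equal to 1
    when [e] is not observed. Every weight other than 1 is read as a failure. *)
Definition lratio (R : realType) (L : nat) (e : 'I_L) (p q : R)
  (aw : {set 'I_L} * 'rV[R]_L) : R :=
  if e \in aw.1 then (if aw.2 ord0 e == 1 then q / p else (1 - q) / (1 - p)) else 1.

(** If [e] is observed, the two densities differ exactly by the factor at [e], so the identity holds
    atom by atom. Otherwise [g] ignores the coordinate [e], whose mean is then irrelevant. *)
Lemma bernoulli_product_change (R : realType) (L : nat) (m m' : 'I_L -> R) e A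
  (g : 'rV[R]_L -> R) :
  0 < m e < 1 -> (forall i, i != e -> m' i = m i) ->
  (forall w w', Defs.mask A w = Defs.mask A w' -> g w = g w') ->
  \sum_(xp <- bernoulli_product m') xp.2 * g xp.1 =
  \sum_(xp <- bernoulli_product m) xp.2 * (lratio e (m e) (m' e) (A, xp.1) * g xp.1).
Proof.
move=> me mm' gA; rewrite (bernoulli_productE m' g).
rewrite (bernoulli_productE m (fun w => lratio e (m e) (m' e) (A, w) * g w)).
case: (boolP (e \in A)) => eA; last first.
  rewrite /lratio /= (negPf eA); under [RHS]eq_bigr do rewrite mul1r.
  apply: (bprob_unobserved (e := e) (g := fun f => g (bvec R f))) => // f f' ff'.
  apply: gA; apply/rowP => i; rewrite !mxE; case: ifP => // iA.
  by rewrite ff' //; apply: contraNneq eA => <-.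
apply: eq_bigr => f _; rewrite mulrA; congr (_ * _).
rewrite /lratio /= eA mxE /bprob !(bigD1 e (P := xpredT)) //=.
rewrite (eq_bigr (fun i => if f i then m i else 1 - m i)); last first.
  by move=> i ie; rewrite mm'.
case: (f e); rewrite ?eqxx 1?eq_sym ?oner_eq0 //=; field; lra.
Qed.

(** * Partition matroids and their optimal items *)

Definition is_block_partition (L K : nat) (B : 'I_K -> {set 'I_L}) : Prop :=
  [/\ forall k, B k != finset.set0,
      forall k k', k != k' -> [disjoint B k & B k'] &
      \bigcup_(k < K) B k = [set: 'I_L]].

Lemma block_cover (L K : nat) (B : 'I_K -> {set 'I_L}) :
  is_block_partition B -> forall e, exists k, e \in B k.
Proof.
move=> [_ _ cov] e; have : e \in [set: 'I_L] by rewrite inE.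
by rewrite -cov => /bigcupP[k _ ek]; exists k.
Qed.

Lemma block_inj (L K : nat) (B : 'I_K -> {set 'I_L}) k k' e :
  is_block_partition B -> e \in B k -> e \in B k' -> k = k'.
Proof.
move=> [_ dis _] ek ek'; apply/eqP; apply: contraT => /dis /pred0P /(_ e) /=.
by rewrite ek ek'.
Qed.

Lemma card_blocks (L K : nat) (B : 'I_K -> {set 'I_L}) (A : {set 'I_L}) :
  is_block_partition B -> #|A| = (\sum_k #|A :&: B k|)%N.
Proof.
move=> Bp; rewrite -sum1_card (eq_bigr (fun e => \sum_(k | e \in B k) 1)%N).
  rewrite (exchange_big_dep predT) //=; apply: eq_bigr => k _.
  by rewrite -sum1_card; apply: eq_bigl => e; rewrite inE.
move=> e _; have [k ek] := block_cover Bp e.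
rewrite (big_pred1 k) // => k'; apply/idP/eqP => [ek'|->//].
exact: (block_inj Bp ek' ek).
Qed.

Lemma partition_matroidP (L K : nat) (B : 'I_K -> {set 'I_L}) (A : {set 'I_L}) :
  reflect (forall k, #|A :&: B k| <= 1)%N (A \in partition_matroid B).
Proof. by rewrite inE; apply: forallP. Qed.

Lemma partition_matroid_setU1 (L K : nat) (B : 'I_K -> {set 'I_L})
  (A : {set 'I_L}) k x :
  is_block_partition B -> A \in partition_matroid B -> x \in B k ->
  A :&: B k = finset.set0 -> x |: A \in partition_matroid B.
Proof.
move=> Bp /partition_matroidP AI xk Ak; apply/partition_matroidP => k'.
rewrite finset.setIUl; have [<-|kk'] := eqVneq k k'.
  by rewrite Ak finset.setU0 (leq_trans (subset_leq_card (finset.subsetIl _ _))) ?cards1.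
suff -> : [set x]%SET :&: B k' = finset.set0 by rewrite finset.set0U.
apply/setP => y; rewrite !inE; apply/negbTE/andP => -[/eqP-> /(block_inj Bp xk)].
exact/eqP.
Qed.

(** For the exchange axiom: the larger set exceeds the smaller one in some block, where the smaller
    one must be empty; its element there can be added. *)
Lemma is_matroid_partition (L K : nat) (B : 'I_K -> {set 'I_L}) :
  is_block_partition B -> is_matroid (partition_matroid B).
Proof.
move=> Bp; split.
- by apply/partition_matroidP => k; rewrite finset.set0I cards0.
- move=> A A' /partition_matroidP AI A'A; apply/partition_matroidP => k.
  exact: leq_trans (subset_leq_card (finset.setSI _ A'A)) (AI k).
move=> A A' AI /partition_matroidP A'I AA'.
have [k] : exists k, (#|A :&: B k| < #|A' :&: B k|)%N.
  apply/existsP; apply: contraTT AA'; rewrite negb_exists -leqNgt => /forallP h.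
  by rewrite !(card_blocks _ Bp); apply: leq_sum => k _; rewrite leqNgt.
move=> lt1; have := leq_trans lt1 (A'I k); rewrite ltnS leqn0 cards_eq0 => /eqP Ak.
have /card_gt0P[x] := leq_ltn_trans (leq0n _) lt1; rewrite inE => /andP[xA' xk].
exists x; last exact: partition_matroid_setU1 Ak.
rewrite inE xA' andbT; apply/negP => xA.
by have := finset.in_set0 x; rewrite -Ak inE xA xk.
Qed.

(** A basis missing a block could be enlarged by any element of it. Conversely, an independent
    superset has at most one element per block, hence is no larger. *)
Lemma is_basis_partition (L K : nat) (B : 'I_K -> {set 'I_L}) (A : {set 'I_L}) :
  is_block_partition B ->
  is_basis (partition_matroid B) A <-> forall k, #|A :&: B k| = 1%N.
Proof.
move=> Bp; split=> [[AI Amax] k|A1].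
  apply/eqP; rewrite eqn_leq (partition_matroidP _ _ AI) lt0n cards_eq0.
  apply/eqP => Ak; have [B0 _ _] := Bp; have /set0Pn[x xk] := B0 k.
  have := Amax _ (partition_matroid_setU1 Bp AI xk Ak) (finset.subsetUr _ _).
  by move=> /setP/(_ x); have := finset.in_set0 x; rewrite -Ak !inE eqxx xk andbT => ->.
split=> [|A' /partition_matroidP A'I AA']; first by apply/partition_matroidP => k; rewrite A1.
apply/esym/eqP; rewrite eqEcard AA' !(card_blocks _ Bp); apply: leq_sum => k _.
by rewrite A1 A'I.
Qed.

Lemma card_basis_partition (L K : nat) (B : 'I_K -> {set 'I_L}) (A : {set 'I_L}) :
  is_block_partition B -> is_basis (partition_matroid B) A -> #|A| = K.
Proof.
move=> Bp /(is_basis_partition _ Bp) A1.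
by rewrite (card_blocks _ Bp) (eq_bigr _ (fun k _ => A1 k)) sum1_card card_ord.
Qed.

(** Exchanging [e] for [e'] keeps one element per block, hence gives a basis, of strictly larger
    mean weight. *)
Lemma optimal_notin (R : realType) (L K : nat) (B : 'I_K -> {set 'I_L})
  (D : seq ('rV[R]_L * R)) (A : {set 'I_L}) k e e' :
  is_block_partition B -> e \in B k -> e' \in B k -> mean D e < mean D e' ->
  optimal_basis (partition_matroid B) D A -> e \notin A.
Proof.
move=> Bp ek e'k lt [/(is_basis_partition _ Bp) A1 Aopt]; apply/negP => eA.
have Ak : A :&: B k = [set e]%SET.
  by apply/esym/eqP; rewrite eqEcard A1 cards1 finset.sub1set inE eA ek.
have e'A : e' \notin A :\ e.
  apply/negP; rewrite !inE => /andP[/negP e'e e'A]; apply: e'e.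
  by have := finset.in_set1 e' e; rewrite -Ak inE e'A e'k.
have bas : is_basis (partition_matroid B) (e' |: (A :\ e)).
  apply/(is_basis_partition _ Bp) => k'; rewrite finset.setIUl.
  have [<-{k'}|kk'] := eqVneq k k'.
    have -> : [set e']%SET :&: B k = [set e']%SET.
      by apply/finset.setIidPl; rewrite finset.sub1set.
    have -> : (A :\ e) :&: B k = finset.set0.
      by rewrite finset.setIDAC Ak finset.setDv.
    by rewrite finset.setU0 cards1.
  rewrite -(A1 k'); congr #|pred_of_set _|.
  have nk x : x \in B k -> x \notin B k'.
    by move=> xk; apply: contra kk' => xk'; rewrite (block_inj Bp xk xk').
  apply/setP => x; rewrite !inE; have [xe'|_] := eqVneq x e'; last first.
    by have [->|_//] := eqVneq x e; rewrite (negPf (nk _ ek)) !andbF.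
  by rewrite xe' (negPf (nk _ e'k)) !andbF.
have := Aopt _ bas; rewrite big_setU1 //= (big_setD1 e eA) /=; lra.
Qed.

(** The membership test repeats the condition in [block_means], so that [block_meansE] holds by
    unfolding. *)
Definition block_min (L K : nat) (B : 'I_K -> {set 'I_L}) : {set 'I_L} :=
  [set e : 'I_L | [exists k, (e \in B k) && [forall i in B k, (e <= i)%N]]].

Lemma block_min_cap (L K : nat) (B : 'I_K -> {set 'I_L}) k :
  is_block_partition B ->
  exists2 e, block_min B :&: B k = [set e]%SET & e \in B k.
Proof.
move=> Bp; have [B0 _ _] := Bp; have /set0Pn[x xk] := B0 k.
case: (@arg_minnP _ x (mem (B k)) (@nat_of_ord L) xk) => e ek emin.
exists e => //; apply/setP => y; rewrite !inE.
apply/andP/eqP => [[/existsP[k' /andP[yk' /forall_inP ymin]] yk]|->].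
  rewrite (block_inj Bp yk' yk) in ymin.
  by apply/val_inj/eqP; rewrite eqn_leq ymin //= emin.
split=> //; apply/existsP; exists k; apply/andP; split=> //.
by apply/forall_inP => i /emin.
Qed.

Lemma is_basis_block_min (L K : nat) (B : 'I_K -> {set 'I_L}) :
  is_block_partition B -> is_basis (partition_matroid B) (block_min B).
Proof.
move=> Bp; apply/(is_basis_partition _ Bp) => k.
by have [e -> _] := block_min_cap k Bp; rewrite cards1.
Qed.

Lemma block_meansE (R : realType) (L K : nat) (B : 'I_K -> {set 'I_L}) (Delta : R) e :
  block_means B Delta e = if e \in block_min B then 2^-1 else 2^-1 - Delta.
Proof. by rewrite inE. Qed.

(** Each episode plays exactly one item of the block. This converts upper bounds on the pulls of the
    other items into a lower bound on those of [e]. *)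
Lemma sum_count_block (L K : nat) (T : eqType) (B : 'I_K -> {set 'I_L}) k
  (tr : seq ({set 'I_L} * T)) :
  (forall aw, aw \in tr -> #|aw.1 :&: B k| = 1%N) ->
  (\sum_(e in B k) count (fun aw : {set 'I_L} * T => e \in aw.1) tr)%N = size tr.
Proof.
elim: tr => [_|aw tr IHtr h] /=; first by rewrite big1.
rewrite big_split /= IHtr => [|aw' aw'tr]; last by apply: h; rewrite inE aw'tr orbT.
rewrite -[RHS]add1n; congr (_ + _)%N; rewrite -(h aw); last exact: mem_head.
rewrite -sum1_card big_mkcond [RHS]big_mkcond /=; apply: eq_bigr => e _.
by rewrite inE andbC; case: (e \in B k); case: (e \in aw.1).
Qed.

(** * Logarithmic inequalities and the change-of-measure bound *)

Lemma ln_le_sub1 (R : realType) (x : R) : 0 < x -> ln x <= x - 1.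
Proof.
by move=> x0; have := @le_ln1Dx R (x - 1); rewrite addrCA subrr addr0; apply; lra.
Qed.

Lemma ln_prod (R : realType) (T : Type) (r : T -> R) (s : seq T) :
  (forall a, 0 < r a) -> ln (\prod_(a <- s) r a) = \sum_(a <- s) ln (r a).
Proof.
move=> r0; elim: s => [|a s IHs]; first by rewrite !big_nil ln1.
by rewrite !big_cons lnM ?IHs ?posrE ?prodr_gt0.
Qed.

(** The mixture [Y] lies between 1 and [X]. If [X <= 1] then [ln X <= ln Y]; otherwise [ln Y >= 0]
    while [ln X - X] is negative. *)
Lemma ln_mixture_ge (R : realType) (X theta x : R) :
  0 < X -> 0 <= theta <= 1 -> 0 < x ->
  ln X - X <= ln x + ((theta + X * (1 - theta)) / x - 1).
Proof.
move=> X0 th x0; set Y := theta + _.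
have lnY : ln X - X <= ln Y.
  have [X1|/ltW X1] := leP X 1.
    have XY : X <= Y by rewrite /Y; nra.
    apply: (@le_trans _ _ (ln X)); first lra.
    by rewrite ler_ln ?posrE //; apply: lt_le_trans XY.
  have Y1 : 1 <= Y by rewrite /Y; nra.
  have := ln_le_sub1 X0; have := ln_ge0 Y1; lra.
have Y0 : 0 < Y by rewrite /Y; nra.
(* The tangent to [ln] at [x] bounds [ln Y] by an affine function of [Y], whose expectation can be
   computed. *)
have := ln_le_sub1 (divr_gt0 Y0 x0); rewrite lnM ?posrE ?invr_gt0 //.
rewrite lnV ?posrE //; lra.
Qed.

(** Relative entropy is at most the chi-square divergence: apply [1 - a / b <= ln (b / a)] to both
    outcomes and average with weights [p] and [1 - p]. *)
Lemma bernoulli_kl_le (R : realType) (p q : R) :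
  0 < p < 1 -> 0 < q < 1 ->
  - ((p - q) ^+ 2 / (q * (1 - q))) <=
  p * ln (q / p) + (1 - p) * ln ((1 - q) / (1 - p)).
Proof.
move=> /andP[p0 p1] /andP[q0 q1].
have lnr (a b : R) : 0 < a -> 0 < b -> 1 - a / b <= ln (b / a).
  move=> a0 b0; have := ln_le_sub1 (divr_gt0 a0 b0).
  by rewrite -[b / a]invf_div lnV ?posrE ?divr_gt0 //; lra.
have h1 := lnr _ _ p0 q0.
have p'0 : 0 < 1 - p by lra.
have q'0 : 0 < 1 - q by lra.
have h2 := lnr _ _ p'0 q'0.
have -> : - ((p - q) ^+ 2 / (q * (1 - q))) =
  p * (1 - p / q) + (1 - p) * (1 - (1 - p) / (1 - q)) by field; lra.
by apply: lerD; apply: ler_wpM2l => //; lra.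
Qed.

Lemma lratio_gt0 (R : realType) (L : nat) (e : 'I_L) (p q : R) aw :
  0 < p < 1 -> 0 < q < 1 -> 0 < lratio e p q aw.
Proof.
move=> /andP[p0 p1] /andP[q0 q1]; rewrite /lratio.
by do 2?case: ifP => _ //; apply: divr_gt0 => //; lra.
Qed.

(* With [X] the likelihood ratio and [theta] the fraction of episodes playing
   [e], this compares [E (ln X - X)] with [E (theta + X * (1 - theta))]. *)
Lemma exp_pulls_change (R : realType) (L : nat) (pol : policy R L)
  (m m' : 'I_L -> R) (e : 'I_L) (n : nat) (x : R) :
  (forall h A, 0 <= pol h A) -> (forall h, \sum_A pol h A = 1) ->
  (forall i, 0 <= m i <= 1) -> 0 < m e < 1 -> 0 < m' e < 1 ->
  (forall i, i != e -> m' i = m i) -> (0 < n)%N -> 0 < x ->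
  - (exp_pulls pol (bernoulli_product m) e n *
     ((m e - m' e) ^+ 2 / (m' e * (1 - m' e)))) <=
  ln x + (exp_pulls pol (bernoulli_product m) e n +
    (n%:R - exp_pulls pol (bernoulli_product m') e n)) / (n%:R * x).
Proof.
move=> pol0 pol1 m01 me m'e mm' n0 x0.
set T := exp_pulls _ _ _ _; set T' := exp_pulls _ _ _ _.
have [D0 D1 _] := is_fdist_bernoulli_product m01.
have n0R : 0 < n%:R :> R by rewrite ltr0n.
pose D := bernoulli_product m.
pose D' := bernoulli_product m'.
have D'1 : \sum_(xp <- D') xp.2 = 1 := sum_bernoulli_product m'.
pose r := lratio e (m e) (m' e).
have r0 aw : 0 < r aw by exact: lratio_gt0.
pose X (t : seq ({set 'I_L} * 'rV[R]_L)) := \prod_(aw <- t) r aw.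
pose N (t : seq ({set 'I_L} * 'rV[R]_L)) : R :=
  (count (fun aw : {set 'I_L} * 'rV[R]_L => e \in aw.1) t)%:R.
have NE t : N t = \sum_(aw <- t) (e \in aw.1)%:R.
  rewrite /N; elim: t => [|aw t IHt]; first by rewrite big_nil.
  by rewrite big_cons /= natrD IHt.
have change G : (forall t t', observed t = observed t' -> G t = G t') ->
    expect pol D n (fun t => X t * G t) = expect pol D' n G.
  move=> Gobs; rewrite /expect (exp_from_change (D := D) (D' := D') (r := r) pol n [::] _ Gobs).
    by rewrite big_nil mul1r.
  by move=> A g gA; apply: bernoulli_product_change.
have EX : expect pol D n X = 1.
  rewrite -(exp_from_const 1 n [::] pol1 D'1) -[RHS]change //.
  by congr expect; apply/funext => t; rewrite mulr1.
(* An episode playing [e] contributes on average [k], minus the relative entropy; any other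
   contributes [ln 1]. Hence the expectation is [k * T], and [T >= 0] allows [k] to be bounded
   below. *)
have ElnX : - (T * ((m e - m' e) ^+ 2 / (m' e * (1 - m' e)))) <=
    expect pol D n (fun t => \sum_(aw <- t) ln (r aw)).
  set k := m e * ln (m' e / m e) + (1 - m e) * ln ((1 - m' e) / (1 - m e)).
  rewrite (expect_additive (h2 := fun aw => k * (e \in aw.1)%:R)) //; last first.
    move=> A; rewrite /r /lratio /=; case: (e \in A) => /=; last first.
      by under eq_bigr do rewrite ln1 mulr0; under [RHS]eq_bigr do rewrite !mulr0.
    rewrite (bernoulli_product_coord m e (fun v => ln (if v == 1 then _ else _))).
    by rewrite eqxx eq_sym oner_eq0 mulr1 -mulr_suml D1 mul1r.
  have -> : expect pol D n (fun t => \sum_(aw <- t) k * (e \in aw.1)%:R) = k * T.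
    transitivity (expect pol D n (fun t => k * N t + 0)).
      by congr expect; apply/funext => t; rewrite NE mulr_sumr addr0.
    by rewrite /expect exp_from_lin exp_from_const // addr0.
  rewrite -mulrN mulrC; apply: ler_wpM2r; last exact: bernoulli_kl_le.
  rewrite /T /exp_pulls -[leLHS](exp_from_const 0 n [::] pol1 D1).
  by apply: (exp_from_le (P := fun=> True)) => // t _ _; rewrite ler0n.
(* The change of measure turns the part weighted by [X] into the expected fraction of episodes not
   playing [e] under [D']. *)
have EY : expect pol D n (fun t => N t / n%:R + X t * (1 - N t / n%:R)) =
    (T + (n%:R - T')) / n%:R.
  have -> : (fun t => N t / n%:R + X t * (1 - N t / n%:R)) =
      (fun t => n%:R^-1 * N t + X t * (1 - N t / n%:R)).
    by apply/funext => t; rewrite mulrC.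
  rewrite /expect exp_from_lin -![exp_from _ _ _ _ _]/(expect _ _ _ _) change.
    have -> : (fun t => 1 - N t / n%:R) = (fun t => (- n%:R^-1) * N t + 1).
      by apply/funext => t; ring.
    rewrite /expect exp_from_lin exp_from_const //.
    have -> : exp_from pol D N n [::] = T by [].
    have -> : exp_from pol D' N n [::] = T' by [].
    by field; lra.
  move=> t t' tt'; congr (1 - _ / _); rewrite !NE.
  have hN (s : seq ({set 'I_L} * 'rV[R]_L)) : \sum_(aw <- s) (e \in aw.1)%:R =
      \sum_(aw <- observed s) (e \in aw.1)%:R :> R by rewrite big_map.
  by rewrite hN tt' -hN.
have main : expect pol D n (fun t => -1 * X t + \sum_(aw <- t) ln (r aw)) <=
    expect pol D n (fun t => x^-1 * (N t / n%:R + X t * (1 - N t / n%:R)) + (ln x - 1)).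
  apply: (exp_from_le (P := fun=> True)) => // t; rewrite addn0 => szt _.
  have X0 : 0 < X t by apply: prodr_gt0.
  have th : 0 <= N t / n%:R <= 1.
    by rewrite divr_ge0 ?ler0n //= ler_pdivrMr // mul1r ler_nat -szt count_size.
  by have := ln_mixture_ge X0 th x0; rewrite -ln_prod // -/(X t); lra.
have lin c G1 G2 : expect pol D n (fun t => c * G1 t + G2 t) =
    c * expect pol D n G1 + expect pol D n G2 := exp_from_lin pol D c G1 G2 n [::].
have const c : expect pol D n (fun=> c) = c := exp_from_const c n [::] pol1 D1.
(* Since [EX] equals 1, the term [-1 * X t] on the left cancels the [- 1] of the tangent on the
   right. *)
move: main; rewrite !lin EX EY const => main.
have -> : (n%:R * x)^-1 = x^-1 / n%:R by rewrite invfM mulrC.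
by apply: (le_trans ElnX); lra.
Qed.

(** * Asymptotics: eventual bounds, regret through pulls, and the limiting rate *)

Lemma limn_einf_ge (R : realType) (u : nat -> \bar R) (x : \bar R) :
  (\forall n \near \oo%classic, (x <= u n)%E) -> (x <= limn_einf u)%E.
Proof.
move=> [N _ Nu]; rewrite limn_einf_lim; apply: lime_ge; first exact: is_cvg_einfs.
exists N => // n /= Nn; apply: le_ereal_inf_tmp => _ [k /= nk <-].
by apply: Nu; apply: leq_trans nk.
Qed.

Lemma sum_le_powR_eventually (R : realType) (I : finType) (P : pred I)
  (f : I -> nat -> R) (a : R) :
  (forall i, P i -> (fun n => f i n / n%:R `^ a) @ \oo --> 0)%classic ->
  \forall n \near \oo%classic, \sum_(i | P i) f i n <= n%:R `^ a.
Proof.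
move=> f0.
have cv : ((fun n => \sum_(i | P i) f i n / n%:R `^ a) @ \oo -->
    \sum_(i | P i) (0 : R))%classic.
  by apply: cvg_big => [|i Pi]; [exact: add_continuous|apply: f0].
rewrite big1_eq in cv.
near=> n; have n0 : 0 < n%:R `^ a :> R.
  by rewrite powR_gt0 // ltr0n; near: n; exact: nbhs_infty_gt.
rewrite -[leRHS]mul1r -ler_pdivrMr // mulr_suml; near: n.
by apply: (cvgr_le _ cv).
Unshelve. all: by end_near. Qed.

(** Conditionally on the played basis, the mean loss is at least [Delta] for each non-minimal item
    in it. Optimality of [Astar] enters only through comparison with the basis [block_min B]. *)
Lemma regret_ge (R : realType) (L K : nat) (B : 'I_K -> {set 'I_L}) (Delta : R)
  (pol : policy R L) (Astar : {set 'I_L}) n :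
  is_block_partition B -> 0 <= Delta <= 2^-1 ->
  (forall h A, 0 <= pol h A) -> (forall h, \sum_A pol h A = 1) ->
  (forall h A, pol h A != 0 -> is_basis (partition_matroid B) A) ->
  optimal_basis (partition_matroid B)
    (bernoulli_product (block_means B Delta)) Astar ->
  Delta * \sum_(e in ~: block_min B)
    exp_pulls pol (bernoulli_product (block_means B Delta)) e n <=
  regret pol (bernoulli_product (block_means B Delta)) Astar n.
Proof.
move=> Bp De pol0 pol1 polP [_ Aopt].
have m01 e : 0 <= block_means B Delta e <= 1.
  by rewrite block_meansE; case: ifP; lra.
have [D0 D1 _] := is_fdist_bernoulli_product m01.
set D := bernoulli_product _ in Aopt D0 D1 *.
pose h (A : {set 'I_L}) := \sum_(e in Astar) mean D e - \sum_(e in A) mean D e.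
have fE A : \sum_(xp <- D) xp.2 * fval A xp.1 = \sum_(e in A) mean D e.
  rewrite /mean exchange_big /=; apply: eq_bigr => xp _.
  by rewrite /fval mulr_sumr.
have -> : regret pol D Astar n = expect pol D n (fun t => \sum_(aw <- t) h aw.1).
  apply: expect_additive => // A.
  under eq_bigr do rewrite mulrBr.
  by rewrite sumrB !fE /= -mulr_suml D1 mul1r.
rewrite mulr_sumr.
have -> : \sum_(e in ~: block_min B) Delta * exp_pulls pol D e n =
  expect pol D n (fun t => \sum_(e in ~: block_min B) Delta *
    (count (fun aw : {set 'I_L} * 'rV[R]_L => e \in aw.1) t)%:R).
  rewrite /expect exp_from_sum; apply: eq_bigr => e _.
  rewrite /exp_pulls /expect -[LHS]addr0.
  rewrite -(exp_from_const 0 n [::] pol1 D1) -exp_from_lin.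
  by congr exp_from; apply/funext => t; rewrite addr0.
apply: (exp_from_le (P := is_basis (partition_matroid B))) => // t _.
elim: t => [_|[A w] t IHt tP]; first by rewrite big_nil big1 // => e _; rewrite mulr0.
rewrite big_cons /=; under eq_bigr do rewrite natrD mulrDr.
rewrite big_split /=; apply: lerD; last first.
  by apply: IHt => aw awt; apply: tP; rewrite inE awt orbT.
have Abas : is_basis (partition_matroid B) A by apply: (tP (A, w)); exact: mem_head.
(* All bases have [K] elements, so their mean weights differ only by the number of non-minimal
   items. *)
have sumE (A' : {set 'I_L}) : is_basis (partition_matroid B) A' ->
    \sum_(e in A') mean D e =
    K%:R / 2 - \sum_(e in ~: block_min B) Delta * (e \in A')%:R.
  move=> A'bas; rewrite -[X in X%:R](card_basis_partition Bp A'bas) -sum1_card natr_sum.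
  rewrite mulr_suml big_mkcond [X in X - _]big_mkcond [X in _ - X]big_mkcond.
  rewrite -sumrB /=; apply: eq_bigr => e _; rewrite mean_bernoulli_product.
  by rewrite block_meansE !inE; do 2?case: ifP => _ /=; lra.
have minbas := is_basis_block_min Bp.
rewrite /h; have := Aopt _ minbas; rewrite (sumE _ Abas) (sumE _ minbas).
rewrite [X in _ - X <= _ -> _]big1 ?subr0 ; first lra.
by move=> e; rewrite inE => /negPf ->; rewrite mulr0.
Qed.

(* The alternative environment raises the mean of [e] to [2^-1 + eps], which
   makes [e] the only optimal item of its block. *)
Lemma exp_pulls_ge_ln (R : realType) (L K : nat) (B : 'I_K -> {set 'I_L})
  (Delta a eps : R) (alg : algorithm R) (e : 'I_L) :
  is_block_partition B -> 0 < Delta < 2^-1 -> 0 < a -> 0 < eps < 2^-1 ->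
  valid_algorithm alg -> consistent alg -> e \notin block_min B ->
  \forall n \near \oo%classic,
    ((1 - a) * ln n%:R - 1) * ((4^-1 - eps ^+ 2) / (Delta + eps) ^+ 2) <=
    exp_pulls (alg L (partition_matroid B))
      (bernoulli_product (block_means B Delta)) e n.
Proof.
move=> Bp De a0 ep valid cons eM.
have matr := is_matroid_partition Bp.
have [k ek] := block_cover Bp e.
have pol0 h A : 0 <= alg L (partition_matroid B) h A by case: (valid _ _ matr h).
have pol1 h : \sum_A alg L (partition_matroid B) h A = 1 by case: (valid _ _ matr h).
have polP h A : alg L (partition_matroid B) h A != 0 ->
    is_basis (partition_matroid B) A by case: (valid _ _ matr h) => _ _; apply.
set pol := alg L _ in pol0 pol1 polP *.
set m := block_means B Delta.
pose m' i := if i == e then 2^-1 + eps else m i.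
have m01 i : 0 <= m i <= 1 by rewrite /m block_meansE; case: ifP; lra.
have m'01 i : 0 <= m' i <= 1 by rewrite /m'; case: ifP => // _; lra.
have me : m e = 2^-1 - Delta by rewrite /m block_meansE (negPf eM).
have m'e : m' e = 2^-1 + eps by rewrite /m' eqxx.
have [D'0 D'1 _] := is_fdist_bernoulli_product m'01.
(* Item [e] is suboptimal under [m], every other item of its block under [m']. Selecting the
   environment by [i == e] puts all these pulls into one sum with a single threshold. *)
have o_pulls i : i \in B k ->
    ((fun n => exp_pulls pol (bernoulli_product (if i == e then m else m')) i n
      / n%:R `^ a) @ \oo --> 0)%classic.
  move=> ik; have [->{i ik}|ie] := eqVneq i e; last first.
    apply: (cons _ _ matr _ (is_fdist_bernoulli_product m'01)) => // A.
    apply: (optimal_notin Bp ik ek).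
    rewrite !mean_bernoulli_product m'e /m' (negPf ie) /m block_meansE.
    by case: ifP; lra.
  apply: (cons _ _ matr _ (is_fdist_bernoulli_product m01)) => // A.
  have [e0 e0M e0k] := block_min_cap k Bp.
  apply: (optimal_notin Bp ek e0k).
  rewrite !mean_bernoulli_product me /m block_meansE.
  have : e0 \in block_min B :&: B k by rewrite e0M finset.in_set1.
  by rewrite finset.in_setI => /andP[-> _]; lra.
have [N _ HN] := sum_le_powR_eventually o_pulls.
(* The successor also ensures [0 < n]. *)
exists N.+1 => // n /= Nn; have n0 : (0 < n)%N by apply: leq_trans Nn.
have {HN}/= := HN n (ltnW Nn).
rewrite (bigD1 e) //= eqxx (eq_bigr (exp_pulls pol (bernoulli_product m') ^~ n)); last first.
  by move=> i /andP[_ /negPf ->].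
move=> uB.
have n0R : 0 < n%:R :> R by rewrite ltr0n.
(* Block [k] is hit in every episode, so [n - T'] is at most the pulls of the other items under
   [m'], which [uB] controls. *)
have blockT : n%:R <= \sum_(i in B k) exp_pulls pol (bernoulli_product m') i n.
  rewrite -[leLHS](exp_from_const (n%:R) n [::] pol1 D'1) -exp_from_sum.
  apply: (exp_from_le (P := is_basis (partition_matroid B))) => // t szt tP.
  rewrite -natr_sum sum_count_block ?szt ?addn0 // => aw /tP.
  by move=> /(is_basis_partition _ Bp).
rewrite (bigD1 e) //= in blockT.
(* The tangent point [x] is n to the power [a - 1]: then [n * x] is n to the power [a], the bound on
   the pulls, and [ln x] is [(a - 1) * ln n]. *)
have x0 : 0 < n%:R `^ (a - 1) :> R by rewrite powR_gt0.
have nx : n%:R * n%:R `^ (a - 1) = n%:R `^ a :> R.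
  rewrite -{1}[n%:R]powRr1 ?ler0n // -powRD; last by apply/implyP => _; rewrite gt_eqF.
  by rewrite addrC subrK.
have me01 : 0 < m e < 1 by lra.
have m'e01 : 0 < m' e < 1 by lra.
have mm' i : i != e -> m' i = m i by rewrite /m' => /negPf ->.
have := exp_pulls_change pol0 pol1 m01 me01 m'e01 mm' n0 x0.
rewrite ln_powR nx me m'e.
set T := exp_pulls _ _ _ _ in uB *.
set T' := exp_pulls _ _ _ _ in blockT *.
have na0 : 0 < n%:R `^ a :> R by rewrite powR_gt0.
have u1 : (T + (n%:R - T')) / n%:R `^ a <= 1.
  by rewrite ler_pdivrMr // mul1r; lra.
have -> : (2^-1 - Delta - (2^-1 + eps)) ^+ 2 / ((2^-1 + eps) * (1 - (2^-1 + eps))) =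
   (Delta + eps) ^+ 2 / (4^-1 - eps ^+ 2).
  congr (_ / _); by field.
move=> h.
rewrite mulrC -ler_pdivlMl; last by rewrite divr_gt0 ?exprn_gt0 //; nra.
rewrite invf_div mulrC; lra.
Qed.

(** A single parameter serves as consistency exponent and as increase of the mean of [e]. The second
    subtracted [x] leaves room to absorb the additive [- 1] of [exp_pulls_ge_ln]. *)
Lemma rate_limit (R : realType) (Delta : R) : 0 < Delta ->
  ((fun x : R => (1 - x - x) * (4^-1 - x ^+ 2) / (Delta + x) ^+ 2) @ (0 : R)
     --> (4 * Delta ^+ 2)^-1)%classic.
Proof.
move=> D0.
have -> : (4 * Delta ^+ 2)^-1 = (1 - 0 - 0) * (4^-1 - 0 ^+ 2) / (Delta + 0) ^+ 2.
  by field; lra.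
apply: cvgM.
  apply: cvgM; first by apply: cvgB => //; apply: cvgB => //; exact: cvg_cst.
  by apply: cvgB; [exact: cvg_cst|exact: exprn_continuous].
apply: cvgV; first by rewrite addr0 sqrf_eq0 gt_eqF.
apply: (@continuous_comp _ _ _ (fun x => Delta + x) (fun y => y ^+ 2)).
  by apply: cvgD => //; exact: cvg_cst.
exact: exprn_continuous.
Qed.

Theorem theorem4 (R : realType) (L K : nat) (Delta : R)
  (B : 'I_K -> {set 'I_L}) (alg : algorithm R) (Astar : {set 'I_L}) :
  (1 <= K)%N -> (K < L)%N ->
  0 < Delta -> Delta < 2^-1 ->
  (forall k, B k != finset.set0) ->
  (forall k k', k != k' -> [disjoint B k & B k']) ->
  \bigcup_(k < K) B k = [set: 'I_L] ->
  valid_algorithm alg ->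
  consistent alg ->
  optimal_basis (partition_matroid B)
    (bernoulli_product (block_means B Delta)) Astar ->
  (((L - K)%:R / (4 * Delta))%:E <=
   limn_einf (fun n : nat =>
     (regret (alg L (partition_matroid B))
        (bernoulli_product (block_means B Delta)) Astar n
      / ln n%:R)%:E))%E.
Proof.
move=> _ KL D0 D2 Bne Bdis Bcov valid cons opt.
have Bp : is_block_partition B by [].
have De : 0 < Delta < 2^-1 by rewrite D0 D2.
have c0 : 0 < (L - K)%:R * Delta by rewrite mulr_gt0 // ltr0n subn_gt0.
apply/lee_subgt0Pr => eta eta0; rewrite -EFinB; apply: limn_einf_ge.
pose g (x : R) := (4^-1 - x ^+ 2) / (Delta + x) ^+ 2.
(* The tolerance is [eta] divided by [(L - K) * Delta], the factor that later multiplies the rate: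
   [Delta] per pull over [L - K] items. *)
have [eps [ep geps]] : exists eps, 0 < eps < 2^-1 /\
    (4 * Delta ^+ 2)^-1 - eta / ((L - K)%:R * Delta) < (1 - eps - eps) * g eps.
  have lim := cvg_at_right_filter (rate_limit D0).
  near (0 : R)^'+%classic => eps; exists eps; split.
    apply/andP; split; near: eps; first exact: nbhs_right_gt.
    by apply: nbhs_right_lt; rewrite invr_gt0.
  rewrite /g [ltRHS]mulrA; near: eps; apply: (cvgr_gt _ lim).
  by rewrite ltrBlDr ltrDl divr_gt0.
have [e0 eh] := andP ep.
have g0 : 0 < g eps by rewrite /g divr_gt0 ?exprn_gt0 //; nra.
(* There are finitely many items, so one threshold on [n] serves them all. *)
have pulls : \forall n \near \oo%classic, forall e, e \in ~: block_min B ->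
    ((1 - eps) * ln n%:R - 1) * g eps <= exp_pulls (alg L (partition_matroid B))
      (bernoulli_product (block_means B Delta)) e n.
  apply: filter_forall => e; have [eM|eM] := boolP (e \in block_min B).
    by near=> n; rewrite finset.in_setC eM.
  have := exp_pulls_ge_ln Bp De e0 ep valid cons eM.
  by apply: filterS.
near=> n.
(* From here on [1 <= eps * ln n], so the additive constant costs at most one more [eps]. *)
have n1 : expR (eps^-1) <= n%:R by near: n; exact: nbhs_infty_ger.
have lnn : eps^-1 <= ln n%:R.
  by rewrite -[leLHS]expRK ler_ln ?posrE ?expR_gt0 // (lt_le_trans _ n1) ?expR_gt0.
have ln0 : 0 < ln n%:R :> R by rewrite (lt_le_trans _ lnn) ?invr_gt0.
have matr := is_matroid_partition Bp.
have De' : 0 <= Delta <= 2^-1 by lra.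
have pol0 h A : 0 <= alg L (partition_matroid B) h A by case: (valid _ _ matr h).
have pol1 h : \sum_A alg L (partition_matroid B) h A = 1 by case: (valid _ _ matr h).
have polP h A : alg L (partition_matroid B) h A != 0 ->
    is_basis (partition_matroid B) A by case: (valid _ _ matr h) => _ _; apply.
have reg := regret_ge n Bp De' pol0 pol1 polP opt.
(* The block minima form a basis, hence number [K]. *)
have cardM : #|~: block_min B| = (L - K)%N.
  by rewrite cardsCs finset.setCK (card_basis_partition Bp (is_basis_block_min Bp)) card_ord.
rewrite lee_fin ler_pdivlMr //; apply: le_trans reg.
apply: (@le_trans _ _
  (Delta * \sum_(e in ~: block_min B) ((1 - eps) * ln n%:R - 1) * g eps)).
  rewrite sumr_const cardM -[X in _ <= _ * X]mulr_natl.
  have -> : (L - K)%:R / (4 * Delta) - eta =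
      (L - K)%:R * Delta * ((4 * Delta ^+ 2)^-1 - eta / ((L - K)%:R * Delta)).
    by field; rewrite (gt_eqF D0) pnatr_eq0 subn_eq0 -ltnNge KL.
  have elnn : 1 <= eps * ln n%:R by rewrite -ler_pdivrMl // mulr1.
  apply: (@le_trans _ _ ((L - K)%:R * Delta * ((1 - eps - eps) * g eps) * ln n%:R)).
    by apply: ler_wpM2r; rewrite ?(ltW ln0) // ler_wpM2l ?(ltW c0) ?(ltW geps).
  rewrite -[leLHS]mulrA [leRHS]mulrA [Delta * _]mulrC ler_wpM2l ?(ltW c0) //.
  by rewrite mulrAC ler_wpM2r ?(ltW g0) //; lra.
rewrite ler_wpM2l ?(ltW D0) //; apply: ler_sum => e eM.
by move: e eM; near: n.
Unshelve. all: by end_near. Qed.
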